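(* Let $n\ge 1$. Suppose that $\mathrm{Im}\,D=\sum_{i=1}^n(\partial_{z_i}-\zeta_i)\,\mathbb{C}[\zeta,z]$ is a Mathieu subspace of the polynomial ring $\mathbb{C}[\zeta,z]=\mathbb{C}[\zeta_1,\ldots,\zeta_n,z_1,\ldots,z_n]$ (this is the statement $IC(n)$). Then the following statement $GVC(n)$ holds: for every differential operator with constant coefficients $\Lambda\in\mathbb{C}[\partial_1,\ldots,\partial_n]$ (where $\partial_i=\partial_{z_i}$) and every $P\in\mathbb{C}[z]=\mathbb{C}[z_1,\ldots,z_n]$ such that $\Lambda^m(P^m)=0$ for all $m\ge 1$, one has, for each $Q\in\mathbb{C}[z]$, $\Lambda^m(QP^m)=0$ for almost all $m$.
   Context: ''For almost all $m$'' means for all positive integers $m$ with only finitely many exceptions. Let $k$ be a field and $R$ a commutative $k$-algebra. A $k$-linear subspace $M$ of $R$ is called a Mathieu subspace of $R$ if the following holds: whenever $f\in R$ satisfies $f^m\in M$ for all $m\ge 1$, then for every $g\in R$ one has $gf^m\in M$ for almost all $m$. Here $k=\mathbb{C}$, and $\partial_{z_i}-\zeta_i$ denotes the operator $h\mapsto \partial h/\partial z_i-\zeta_i h$ on $\mathbb{C}[\zeta,z]$. *)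

(* Defs.v *)
From HB Require Import structures.
From mathcomp Require Import all_boot all_order all_algebra.
From mathcomp Require Import reals.
From mathcomp Require Import complex mpoly.

Set Implicit Arguments.
Unset Strict Implicit.
Unset Printing Implicit Defensive.

Import GRing.Theory.
Local Open Scope ring_scope.

Definition almost_all (E : nat -> Prop) : Prop :=
  exists s : seq nat, forall m : nat, (0 < m)%N -> m \notin s -> E m.

(* Subsets are Prop-valued: membership in an image need not be decidable. *)
Definition is_subspace (k : fieldType) (V : lmodType k) (M : V -> Prop) : Prop :=
  M 0 /\ forall (a : k) (u v : V), M u -> M v -> M (a *: u + v).

Definition is_Mathieu_subspace (k : fieldType) (A : comAlgType k)
    (M : A -> Prop) : Prop :=
  is_subspace M /\
  forall f : A, (forall m : nat, (1 <= m)%N -> M (f ^+ m)) ->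
  forall g : A, almost_all (fun m => M (g * f ^+ m)).

Section ImageAndGeneralizedVanishing.
Variables (R : realType) (n : nat).

Local Notation C := R[i].

(* C[zeta, z] is the polynomial ring in n + n variables: the first n of them
   are the zeta_i, the last n are the z_i. *)
Definition zeta (i : 'I_n) : {mpoly C[n + n]} := 'X_(lshift n i).

Definition dz (i : 'I_n) (h : {mpoly C[n + n]}) : {mpoly C[n + n]} :=
  h^`M(rshift n i).

Definition ImD (f : {mpoly C[n + n]}) : Prop :=
  exists h : 'I_n -> {mpoly C[n + n]},
    f = \sum_(i < n) (dz i (h i) - zeta i * h i).

Definition IC : Prop := is_Mathieu_subspace ImD.

(* A constant-coefficient operator is given by its symbol L: the monomial
   'X_[a] stands for the iterated partial derivative of multi-index a. *)
Definition diffop (L P : {mpoly C[n]}) : {mpoly C[n]} :=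
  \sum_(a <- msupp L) L@_a *: P^`M[a].

(* The m-th power of an operator is its m-fold composition. *)
Definition GVC : Prop :=
  forall L P : {mpoly C[n]},
    (forall m : nat, (1 <= m)%N -> iter m (diffop L) (P ^+ m) = 0) ->
  forall Q : {mpoly C[n]},
    almost_all (fun m => iter m (diffop L) (Q * P ^+ m) = 0).

End ImageAndGeneralizedVanishing.

(* Main.v *)
From HB Require Import structures.
Require Import Defs.
From mathcomp Require Import all_boot all_order all_algebra.
From mathcomp Require Import reals.
From mathcomp Require Import complex mpoly ssrcomplements.

(** Send a polynomial in [zeta] and [z] to a polynomial in [z] by writing every
    [zeta_i] to the left and reading it as the derivation [d/dz_i]: this is the
    linear map [diff_eval], with [zeta^a z^b |-> d^a (z^b)].  It satisfies
    [diff_eval (L(zeta) P(z)) = L(d) P], and its kernel is exactly the image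
    [Im D].  The two inclusions are used in the following forms.

    - [diff_eval_ImD]: [Im D] lies in the kernel, because
      [diff_eval (zeta_i h)] and [diff_eval (dh/dz_i)] are the same polynomial.
      As [diff_eval] is the identity on [C[z]], the only polynomial in [z] alone
      that lies in [Im D] is [0].
    - [ImD_diffop]: modulo [Im D], multiplication by [zeta_i] is [d/dz_i], so
      [L(zeta) P(z)] is congruent to [L(d) P], a polynomial in [z] alone.
      Since [d/dz_i] commutes with multiplication by [zeta_j], this can be
      repeated: [L(zeta)^m P(z)] is congruent to [L(d)^m P].

    Together, [L(zeta)^m P(z)] lies in [Im D] if and only if [L(d)^m P = 0]
    ([ImD_iter_diffop]).  Given [L] and [P], take [f = L(zeta) P(z)].  The
    hypothesis [L(d)^m (P^m) = 0] says that [f^m] is in [Im D], and the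
    conclusion [L(d)^m (Q P^m) = 0] says that [Q f^m] is in [Im D]; the Mathieu
    property, applied to [f] and [g = Q(z)], goes from the one to the other for
    almost all [m]. *)

Set Implicit Arguments.
Unset Strict Implicit.
Unset Printing Implicit Defensive.

Import GRing.Theory.
Local Open Scope ring_scope.

(** * Linear maps given by their values on monomials *)

Section LinearExtension.
Variables (K : comNzRingType) (n : nat) (V : lmodType K) (F : 'X_{1..n} -> V).

Definition linext (p : {mpoly K[n]}) : V := \sum_(m <- msupp p) p@_m *: F m.

(** The support varies with the polynomial; summing over all monomials of
    bounded degree makes linearity visible. *)
Lemma linextwE k p : (msize p <= k)%N ->
  linext p = \sum_(m : 'X_{1..n < k}) p@_m *: F m.
Proof.
move=> le_pk; rewrite /linext (big_mksub 'X_{1..n < k}) //=.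
- by rewrite big_rmcond //= => m /memN_msupp_eq0 ->; rewrite scale0r.
- exact: msupp_uniq.
- by move=> m /msize_mdeg_lt /leq_trans; apply.
Qed.

Lemma linext_is_linear : linear linext.
Proof.
move=> c p q; set r := c *: p + q.
pose k := maxn (msize r) (maxn (msize p) (msize q)).
rewrite !(@linextwE k) ?leq_max ?leqnn ?orbT // scaler_sumr -big_split /=.
by apply: eq_bigr => m _; rewrite mcoeffD mcoeffZ scalerDl scalerA.
Qed.

HB.instance Definition _ :=
  GRing.isLinear.Build K {mpoly K[n]} V _ linext linext_is_linear.

Lemma linextX m : linext 'X_[m] = F m.
Proof. by rewrite /linext msuppX big_seq1 mcoeffX eqxx scale1r. Qed.

End LinearExtension.

Lemma mnm_add_ind n (S : 'X_{1..n} -> Prop) :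
  S 0%MM -> (forall a b, S a -> S b -> S (a + b)%MM) ->
  (forall i, S U_(i)%MM) -> forall a, S a.
Proof.
move=> S0 SD SU a; rewrite [a]multinomUE_id; apply: big_ind => // i _.
by elim: (a i) => [|k IH]; rewrite ?mulm0n // mulmS; apply: SD.
Qed.

Section ImageOfD.
Variables (R : realType) (n : nat).
Local Notation C := R[i].
Implicit Types (a b : 'X_{1..n}) (L P Q : {mpoly C[n]}).
Implicit Types (f g h : {mpoly C[n + n]}).

(** * Polynomials in zeta alone and in z alone *)

Definition in_zeta : {mpoly C[n]} -> {mpoly C[n + n]} :=
  comp_mpoly [tuple zeta R i | i < n].
HB.instance Definition _ := GRing.LRMorphism.copy in_zeta
  (comp_mpoly [tuple zeta R i | i < n]).

Definition in_z : {mpoly C[n]} -> {mpoly C[n + n]} :=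
  comp_mpoly [tuple 'X_(rshift n i) | i < n].
HB.instance Definition _ := GRing.LRMorphism.copy in_z
  (comp_mpoly [tuple 'X_(rshift n i) | i < n]).

HB.instance Definition _ i :=
  GRing.Linear.copy (@dz R n i) (mderiv (rshift n i)).

Definition mjoin a b : 'X_{1..n + n} :=
  [multinom match split i with inl j => a j | inr j => b j end | i < n + n].
Definition mzeta (m : 'X_{1..n + n}) : 'X_{1..n} :=
  [multinom m (lshift n i) | i < n].
Definition mz (m : 'X_{1..n + n}) : 'X_{1..n} :=
  [multinom m (rshift n i) | i < n].

Lemma mjoin_l a b i : mjoin a b (lshift n i) = a i.
Proof.
rewrite mnmE; case: split_ordP => j; first by move/lshift_inj ->.
by move/eqP; rewrite eq_lrshift.
Qed.

Lemma mjoin_r a b i : mjoin a b (rshift n i) = b i.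
Proof.
rewrite mnmE; case: split_ordP => j; last by move/rshift_inj ->.
by move/eqP; rewrite eq_rlshift.
Qed.

Lemma mzeta_mjoin a b : mzeta (mjoin a b) = a.
Proof. by apply/mnmP => i; rewrite mnmE mjoin_l. Qed.

Lemma mz_mjoin a b : mz (mjoin a b) = b.
Proof. by apply/mnmP => i; rewrite mnmE mjoin_r. Qed.

Lemma mjoinK m : mjoin (mzeta m) (mz m) = m.
Proof.
apply/mnmP => i; case: (split_ordP i) => j ->.
  by rewrite mjoin_l mnmE.
by rewrite mjoin_r mnmE.
Qed.

Lemma mjoinDl a a' b : mjoin (a + a')%MM b = (mjoin a 0 + mjoin a' b)%MM.
Proof.
apply/mnmP => i; case: (split_ordP i) => j ->.
  by rewrite mnmDE !mjoin_l mnmDE.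
by rewrite mnmDE !mjoin_r mnm0E.
Qed.

Lemma mjoin_U i : mjoin U_(i) 0 = U_(lshift n i)%MM.
Proof.
apply/mnmP => k; case: (split_ordP k) => j ->.
  by rewrite mjoin_l !mnm1E eq_lshift.
by rewrite mjoin_r mnm0E mnm1E eq_lrshift.
Qed.

Lemma mpolyX_mjoin a b : 'X_[mjoin a b] = in_zeta 'X_[a] * in_z 'X_[b].
Proof.
rewrite mpolyXE_id big_split_ord /in_zeta /in_z !comp_mpolyX; congr (_ * _);
  by apply: eq_bigr => i _; rewrite tnth_mktuple ?mjoin_l ?mjoin_r.
Qed.

Lemma in_zetaC c : in_zeta c%:MP = c%:MP.
Proof. exact: comp_mpolyC. Qed.

Lemma in_zetaX a : in_zeta 'X_[a] = 'X_[mjoin a 0].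
Proof. by rewrite mpolyX_mjoin mpolyX0 rmorph1 mulr1. Qed.

Lemma in_zX b : in_z 'X_[b] = 'X_[mjoin 0 b].
Proof. by rewrite mpolyX_mjoin mpolyX0 rmorph1 mul1r. Qed.

Lemma dz_mjoin i a b : dz i 'X_[mjoin a b] = (b i)%:R *: 'X_[mjoin a (b - U_(i))%MM]
  :> {mpoly C[n + n]}.
Proof.
rewrite /dz mderivX mjoin_r; congr (_ *: 'X_[_]).
apply/mnmP => k; case: (split_ordP k) => j ->.
  by rewrite mnmBE !mjoin_l mnm1E eq_rlshift subn0.
by rewrite mnmBE !mjoin_r mnmBE !mnm1E eq_rshift.
Qed.

Lemma dz_in_zeta i L : dz i (in_zeta L) = 0.
Proof.
elim/mpolyind: L => [|c a L _ _ IH]; first by rewrite !linear0.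
rewrite [in_zeta _]linearP [dz _ _]linearP /= in_zetaX dz_mjoin mnm0E.
by rewrite scale0r scaler0 add0r IH.
Qed.

Lemma dz_in_z i P : dz i (in_z P) = in_z P^`M(i).
Proof.
elim/mpolyind: P => [|c b P _ _ IH]; first by rewrite !linear0.
rewrite [in_z _]linearP [dz _ _]linearP [in RHS]mderivD mderivZ.
rewrite [in RHS]linearP /= in_zX dz_mjoin mderivX [in_z (_ *: _)]linearZ /= in_zX.
by rewrite IH.
Qed.

(** * Reading zeta as differentiation kills the image of D *)

Definition diff_eval : {mpoly C[n + n]} -> {mpoly C[n]} :=
  linext (fun m => 'X_[mz m]^`M[mzeta m]).
HB.instance Definition _ := GRing.Linear.on diff_eval.

Lemma diff_evalX a b : diff_eval 'X_[mjoin a b] = 'X_[b]^`M[a].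
Proof. by rewrite /diff_eval linextX mzeta_mjoin mz_mjoin. Qed.

Lemma diff_eval_in_z P : diff_eval (in_z P) = P.
Proof.
elim/mpolyind: P => [|c b P _ _ IH]; first by rewrite !linear0.
by rewrite [in_z _]linearP [diff_eval _]linearP /= in_zX diff_evalX mderivm0m IH.
Qed.

Lemma diff_eval_D i h : diff_eval (dz i h - zeta R i * h) = 0.
Proof.
elim/mpolyind: h => [|c m h _ _ IH].
  by rewrite !linear0 mulr0 subr0 linear0.
have -> : dz i (c *: 'X_[m] + h) - zeta R i * (c *: 'X_[m] + h) =
    c *: (dz i 'X_[m] - zeta R i * 'X_[m]) + (dz i h - zeta R i * h).
  by rewrite [dz _ _]linearP /= mulrDr -scalerAr scalerBr opprD addrACA.
rewrite [diff_eval _]linearP /= IH addr0 -[m]mjoinK.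
move: (mzeta m) (mz m) => a b.
have -> : zeta R i * 'X_[mjoin a b] = 'X_[mjoin (U_(i) + a)%MM b].
  by rewrite mjoinDl mjoin_U mpolyXD.
rewrite dz_mjoin [diff_eval _]linearB /= [diff_eval (_ *: _)]linearZ /= !diff_evalX.
by rewrite mderivmDm mderivmU1m mderivX mderivmZ subrr scaler0.
Qed.

Lemma diff_eval_ImD f : ImD f -> diff_eval f = 0.
Proof.
case=> h ->; rewrite linear_sum big1 // => i _.
exact: diff_eval_D.
Qed.

(** * Modulo the image of D, zeta acts as differentiation *)

Lemma ImD0 : @ImD R n 0.
Proof.
by exists (fun=> 0); rewrite big1 // => i _; rewrite linear0 mulr0 subr0.
Qed.

Lemma ImDD f g : ImD f -> ImD g -> ImD (f + g).
Proof.
case=> [u ->] [v ->]; exists (fun i => u i + v i); rewrite -big_split /=.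
by apply: eq_bigr => i _; rewrite linearD /= mulrDr opprD addrACA.
Qed.

(** [Im D] is a [C[zeta]]-submodule, since a polynomial in [zeta] alone is a
    constant for every [d/dz_i]. *)
Lemma ImD_mul_zeta L f : ImD f -> ImD (in_zeta L * f).
Proof.
case=> h ->; exists (fun i => in_zeta L * h i); rewrite mulr_sumr.
apply: eq_bigr => i _; rewrite {2}/dz mderivM -/(dz i (in_zeta L)) dz_in_zeta.
by rewrite mul0r add0r mulrBr [zeta R i * (_ * _)]mulrCA.
Qed.

Lemma ImD_scale c f : ImD f -> ImD (c *: f).
Proof.
move=> Df; rewrite -mul_mpolyC; have := @ImD_mul_zeta c%:MP f Df.
by rewrite in_zetaC.
Qed.

(** For a single [zeta_i] the congruence is, up to sign, the definition of
    [Im D]; stability of [Im D] under multiplication by [zeta] lets such steps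
    be chained. *)
Lemma ImD_mderivm a P : ImD (in_zeta 'X_[a] * in_z P - in_z P^`M[a]).
Proof.
pose S a := forall P, ImD (in_zeta 'X_[a] * in_z P - in_z P^`M[a]).
have S0 : S 0%MM.
  move=> {}P; rewrite mpolyX0 rmorph1 mul1r mderivm0m subrr.
  exact: ImD0.
have SD a1 a2 : S a1 -> S a2 -> S (a1 + a2)%MM.
  move=> S1 S2 {}P.
  have -> : in_zeta 'X_[(a1 + a2)%MM] = in_zeta 'X_[a1] * in_zeta 'X_[a2].
    by rewrite mpolyXD rmorphM.
  rewrite -mulrA -(subrK (in_zeta 'X_[a1] * in_z P^`M[a2]) (_ * _)) -addrA.
  rewrite -mulrBr addmC mderivmDm; apply: ImDD; last exact: S1.
  exact: ImD_mul_zeta (S2 P).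
have SU i : S U_(i)%MM.
  move=> {}P; rewrite in_zetaX mjoin_U mderivmU1m -dz_in_z -opprB -scaleN1r.
  apply: ImD_scale; exists (fun j => if j == i then in_z P else 0).
  rewrite (bigD1 i) //= eqxx big1 ?addr0 // => j /negPf ->.
  by rewrite linear0 mulr0 subr0.
exact: (mnm_add_ind S0 SD SU a P).
Qed.

Lemma ImD_diffop L P : ImD (in_zeta L * in_z P - in_z (diffop L P)).
Proof.
have -> : in_zeta L * in_z P - in_z (diffop L P) =
    \sum_(a <- msupp L) L@_a *: (in_zeta 'X_[a] * in_z P - in_z P^`M[a]).
  rewrite {1}[L]mpolyE [in_zeta _]linear_sum [in_z (diffop _ _)]linear_sum.
  rewrite mulr_suml -sumrB; apply: eq_bigr => a _ /=.
  by rewrite [in_zeta _]linearZ [in_z (_ *: _)]linearZ /= -scalerAl scalerBr.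
apply: (big_ind (@ImD R n)) => [|f g|a _]; [exact: ImD0|exact: ImDD|].
exact/ImD_scale/ImD_mderivm.
Qed.

Lemma ImD_diffop_iter L P m :
  ImD (in_zeta L ^+ m * in_z P - in_z (iter m (diffop L) P)).
Proof.
elim: m => [|m IH]; first by rewrite mul1r subrr; apply: ImD0.
rewrite exprS -mulrA -(subrK (in_zeta L * in_z (iter m (diffop L) P)) (_ * _)).
rewrite -addrA -mulrBr; apply: ImDD; last exact: ImD_diffop.
exact: ImD_mul_zeta.
Qed.

(** [L(zeta)^m P(z)] is congruent to a polynomial in [z] alone, and [diff_eval]
    shows that such a polynomial is in [Im D] only if it is [0]. *)
Lemma ImD_iter_diffop L P m :
  ImD (in_zeta L ^+ m * in_z P) <-> iter m (diffop L) P = 0.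
Proof.
have := ImD_diffop_iter L P m; set f := _ * _; set r := iter _ _ _ => Dfr.
split=> [Df | r0]; last by move: Dfr; rewrite r0 linear0 subr0.
move: (diff_eval_ImD Df) (diff_eval_ImD Dfr); rewrite linearB /=.
by rewrite diff_eval_in_z => -> /eqP; rewrite sub0r oppr_eq0 => /eqP.
Qed.

End ImageOfD.

(** * From the image conjecture to the vanishing conjecture *)

Theorem theorem3p1 (R : realType) (n : nat) (hn : (1 <= n)%N) :
  IC R n -> GVC R n.
Proof.
move=> [_ mathieu] L P LP0 Q; pose f := in_zeta L * in_z P.
have fE m : f ^+ m = in_zeta L ^+ m * in_z (P ^+ m).
  by rewrite exprMn rmorphXn.
have Df m : (1 <= m)%N -> ImD (f ^+ m).
  by move=> m1; rewrite fE; apply/ImD_iter_diffop/LP0.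
have [s Ds] := mathieu f Df (in_z Q).
exists s => m m0 ms; apply/ImD_iter_diffop; have := Ds m m0 ms.
by rewrite fE mulrCA rmorphM.
Qed.
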